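(* Let $H$ be a fixed tree, let $c>0$ and $A<1$ be constants, and let $m(n)$ be integers with $m(n)\in[cn,An]$ for all $n$. Then there exists a constant $\lambda=\lambda(H,c,A)>0$ such that for all sufficiently large $n$, \[ \mathbf{P}[P_{n,m}\text{ has fewer than } \lambda n \text{ components isomorphic to } H] < e^{-\lambda n}. \]
   Context: $\mathcal{P}(n,m)$ denotes the set of all (simple, labelled) planar graphs on the vertex set $\{1,2,\ldots,n\}$ with exactly $m$ edges, and $P_{n,m}$ denotes a graph chosen uniformly at random from $\mathcal{P}(n,m)$. *)

(* Defs.v *)
From HB Require Import structures.
From mathcomp Require Import all_boot all_order all_algebra.
From mathcomp Require Import all_classical all_reals all_analysis.

Set Implicit Arguments.
Unset Strict Implicit.
Unset Printing Implicit Defensive.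

Import Order.TTheory GRing.Theory Num.Theory.
Import numFieldNormedType.Exports.

Local Open Scope classical_set_scope.
Local Open Scope ring_scope.

Record sgraph (V : finType) := SGraph {
  edges : {set {set V}};
  edges_card2 : [forall e in edges, #|e| == 2%N] }.

HB.instance Definition _ (V : finType) := [isSub for @edges V].
HB.instance Definition _ (V : finType) := [Finite of sgraph V by <:].

(* Irreflexive, since [set x; x]%SET has cardinal 1. *)
Definition adj (V : finType) (G : sgraph V) : rel V :=
  fun x y => [set x; y]%SET \in edges G.

Definition connected_graph (V : finType) (G : sgraph V) : Prop :=
  (0 < #|V|)%N /\ forall x y : V, connect (adj G) x y.

(* The bound on the size is needed because ucycle accepts [::] and, for an
   edge xy, the sequence [:: x; y]. *)
Definition acyclic_graph (V : finType) (G : sgraph V) : Prop :=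
  forall s : seq V, (2 < size s)%N -> ~ ucycle (adj G) s.

Definition is_tree (V : finType) (G : sgraph V) : Prop :=
  connected_graph G /\ acyclic_graph G.

Definition components (V : finType) (G : sgraph V) : {set {set V}} :=
  equivalence_partition (connect (adj G)) [set: V]%SET.

(* The subgraph of G induced by C is isomorphic to H. *)
Definition induced_iso (V W : finType) (G : sgraph V) (C : {set V})
    (H : sgraph W) : bool :=
  [exists f : {ffun W -> V},
    [&& injectiveb f, (f @: [set: W])%SET == C &
        [forall x, forall y, adj G (f x) (f y) == adj H x y]]].

Definition num_components_iso (V W : finType) (G : sgraph V) (H : sgraph W)
    : nat :=
  #|[set C in components G | induced_iso G C H]%SET|.

(* A drawing of G in the plane: vertices are sent to distinct points, and each
   edge to a simple arc, parametrized by the unit interval, that joins the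
   images of its ends; arcs meet vertices and each other only at their ends.
   The values of arc outside edges G are irrelevant. *)
Record plane_drawing (R : realType) (V : finType) (G : sgraph V)
    (pt : V -> R * R) (arc : {set V} -> R -> R * R) : Prop := PlaneDrawing {
  drawing_pt_inj : injective pt;
  drawing_arc_continuous : forall e, e \in edges G ->
    {within `[0, 1], continuous (arc e)};
  drawing_arc_simple : forall e, e \in edges G ->
    {in `[0, 1] &, injective (arc e)};
  drawing_arc_ends : forall e, e \in edges G ->
    exists x y : V, [/\ e = [set x; y]%SET, arc e 0 = pt x & arc e 1 = pt y];
  drawing_arc_pt : forall e, e \in edges G ->
    forall (t : R) (v : V), t \in `]0, 1[ -> arc e t <> pt v;
  drawing_arc_disjoint : forall e e', e \in edges G -> e' \in edges G ->
    e != e' -> forall s t : R, s \in `]0, 1[ -> t \in `]0, 1[ ->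
    arc e s <> arc e' t }.

Definition planar (R : realType) (V : finType) (G : sgraph V) : Prop :=
  exists (pt : V -> R * R) (arc : {set V} -> R -> R * R),
    plane_drawing G pt arc.

Definition planar_graphs (R : realType) (n m : nat) : {set sgraph 'I_n} :=
  [set G : sgraph 'I_n | (#|edges G| == m) && `[< planar R G >]]%SET.

(* Probability of the event E for a uniformly random element of
   planar_graphs R n m; by convention 0 if there is no such graph. *)
Definition planar_prob (R : realType) (n m : nat) (E : pred (sgraph 'I_n)) : R :=
  #|[set G in planar_graphs R n m | E G]%SET|%:R / #|planar_graphs R n m|%:R.

Arguments planar_prob R n m E : clear implicits.

(* Main.v *)
(* Since [m <= A n], the sum over the components [C] of [#|C| - e(C)] is at least
   [(1 - A) n], and each term is at most 1; hence linearly many components are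
   trees, and linearly many of these have bounded size. Put [h = #|W|]. Choose
   [h + 1] small tree components, with union [S], and [h - 1] edges outside [S];
   delete these edges and those inside [S], and build on [S] a copy of [H] and a
   star. Vertices and edges are preserved, and so is planarity, since the two
   new trees can be drawn beside the rest. There are of order [n ^ (2h)] such
   choices, whereas a graph with at most [j] copies of [H] arises in at most
   [O(j n ^ (2h - 1))] ways: one vertex in a copy of [H], another vertex, [h - 1]
   pairs of vertices and a bounded amount of information on [S]. As a switch
   creates boundedly many copies, the number of graphs with at most [j] copies
   grows by a factor at least [e] when [j] grows by a constant, as long as
   [j <= mu n]; iterating [lambda n] times gives the bound. *)
Require Import Defs.
From mathcomp Require Import all_boot all_order all_algebra.
From mathcomp Require Import all_classical all_reals all_analysis.
From mathcomp Require Import fintype finset zify ring lra.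

Set Implicit Arguments.
Unset Strict Implicit.
Unset Printing Implicit Defensive.

Import Order.TTheory GRing.Theory Num.Theory.
Import numFieldNormedType.Exports.

Local Open Scope ring_scope.

(** * Edges, adjacency and vertex sets grown one vertex at a time *)

Lemma card_edge (V : finType) (G : sgraph V) (e : {set V}) :
  e \in edges G -> #|e| = 2.
Proof. by move=> eG; have /forallP/(_ e) := edges_card2 G; rewrite eG => /eqP. Qed.

Lemma edge_ends (V : finType) (G : sgraph V) (e : {set V}) :
  e \in edges G -> exists x y, x != y /\ e = [set x; y]%SET.
Proof. by move=> /card_edge /eqP /cards2P [x [y [xy ->]]]; exists x, y. Qed.

Lemma adj_sym (V : finType) (G : sgraph V) : symmetric (adj G).
Proof. by move=> x y; rewrite /adj setUC. Qed.

Lemma connect_adj_sym (V : finType) (G : sgraph V) : connect_sym (adj G).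
Proof. exact/sym_connect_sym/adj_sym. Qed.

Definition comp_of (V : finType) (G : sgraph V) (x : V) : {set V} :=
  [set y | connect (adj G) x y]%SET.

Definition inner (V : finType) (G : sgraph V) (C : {set V}) : {set {set V}} :=
  [set e in edges G | e \subset C]%SET.

(* The head of the list is the vertex added last. *)
Fixpoint grown (V : eqType) (e : rel V) (s : seq V) : bool :=
  if s is v :: s' then
    (s' == [::]) || [&& v \notin s', has (e v) s' & grown e s']
  else false.

Lemma grown_uniq (V : eqType) (e : rel V) (s : seq V) : grown e s -> uniq s.
Proof.
elim: s => //= v s IH /orP[/eqP -> //|/and3P[-> _ /IH ->]]//.
Qed.

(** Greedy search from [x]: as long as the class of [x] is not exhausted, some vertex outside the
    list has a neighbour in it. *)
Lemma grown_span (V : finType) (e : rel V) (x : V) : symmetric e ->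
  exists2 s, grown e s & s =i connect e x.
Proof.
move=> esym.
have cs := sym_connect_sym esym.
suff: forall k, (k < #|connect e x|)%N ->
    exists s, [/\ grown e s, x \in s, size s = k.+1 & {subset s <= connect e x}].
  have c0 : (0 < #|connect e x|)%N by apply/card_gt0P; exists x; exact: connect0.
  case/(_ #|connect e x|.-1); first by rewrite prednK.
  move=> s [gs _ ss sub]; exists s => //.
  apply/subset_cardP; last exact/subsetP.
  by rewrite (card_uniqP (grown_uniq gs)) ss prednK.
elim=> [|k IH] kc.
  exists [:: x]; split => //=; first exact: mem_head.
  by move=> y; rewrite inE => /eqP ->; exact: connect0.
case: IH => [|s [gs xs ss sub]]; first exact: ltnW.
have [|/existsPn none] := boolP [exists v, (v \notin s) && has (e v) s].
  case/existsP=> v /andP[vs hv]; exists (v :: s); split=> //=.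
  - by rewrite vs hv gs orbT.
  - by rewrite inE xs orbT.
  - by rewrite ss.
  - move=> y; rewrite inE => /orP[/eqP ->|/sub//].
    case/hasP: hv => w ws evw; apply: connect_trans (sub _ ws) _.
    by apply: connect1; rewrite esym.
(* With no vertex left to add, [s] is closed under [e], so it contains the whole class of [x],
   against [kc]. *)
have cl : fingraph.closed e (mem s).
  apply: (intro_closed cs) => a b eab sa; apply: contraT => sb.
  have := none b; rewrite sb /= => /hasPn /(_ a sa).
  by rewrite esym eab.
move: kc; rewrite ltnNge -ss -(card_uniqP (grown_uniq gs)).
rewrite subset_leq_card //; apply/subsetP => y cxy.
by rewrite -(closed_connect cl cxy).
Qed.

(** The connecting path stays inside [s]; a vertex outside [s] with two neighbours in [s] can
    therefore close it into a cycle. *)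
Lemma grown_connect (V : finType) (e : rel V) (s : seq V) : symmetric e ->
  grown e s -> {in s &, forall x y,
    connect [rel a b | [&& a \in s, b \in s & e a b]] x y}.
Proof.
move=> esym; elim: s => //= v s IH /orP[/eqP -> x y|/and3P[vs hv gs]].
  by rewrite !inE => /eqP -> /eqP ->; exact: connect0.
set r := [rel a b | _].
have rs : symmetric r by move=> a b; rewrite /r /= esym andbCA.
have cs := sym_connect_sym rs.
have sub : {in s &, forall x y, connect r x y}.
  move=> x y xs ys; have := IH gs x y xs ys.
  apply: connect_sub => a b /= /and3P[sa sb eab]; apply: connect1.
  by rewrite /r /= !inE sa sb eab !orbT.
case/hasP: hv => w ws evw.
have vw : connect r v w.
  by apply: connect1; rewrite /r /= !inE eqxx ws evw orbT.
suff to_w : forall x, x \in v :: s -> connect r x w.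
  by move=> x y xs ys; apply: connect_trans (to_w _ xs) _; rewrite cs to_w.
by move=> x; rewrite inE => /orP[/eqP ->//|xs]; exact: sub.
Qed.

(** * Trees: edge counts and noncrossing layouts on a line *)

(** This is a one-page book embedding: arcs drawn above a line do not cross. As [[set a; b]] is
    unordered, both orientations of every edge are covered. *)
Definition noncrossing (V : finType) (pos : V -> nat) (E : {set {set V}}) :=
  forall a b c d, [set a; b]%SET \in E -> [set c; d]%SET \in E ->
    (pos a < pos c)%N -> (pos c < pos b)%N -> (pos b < pos d)%N -> False.

(** Each added vertex brings at least the edge to its neighbour in the list. *)
Lemma inner_grown_ge (V : finType) (G : sgraph V) (s : seq V) :
  grown (adj G) s -> (size s <= #|inner G [set x in s]|.+1)%N.
Proof.
elim: s => //= v s IH /orP[/eqP -> //|/and3P[vs /hasP[u us avu] gs]].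
rewrite ltnS (leq_trans (IH gs)) //.
apply: proper_card; apply/properP; split.
  apply/subsetP => e; rewrite !inE => /andP[-> /subsetP es].
  by apply/subsetP => x /es; rewrite !inE => ->; rewrite orbT.
exists [set v; u]%SET; first rewrite inE -/(adj G v u) avu /=.
  by apply/subsetP => x; rewrite !inE => /orP[->//|/eqP ->]; rewrite us orbT.
rewrite inE negb_and; apply/orP; right; apply/subsetPn; exists v.
  by rewrite !inE eqxx.
by rewrite inE.
Qed.

(** Two distinct neighbours of [v] would be joined by a simple path inside [s], which [v] would
    close into a cycle. *)
Lemma grown_parent_uniq (V : finType) (G : sgraph V) (s : seq V) (v u w : V) :
  acyclic_graph G -> grown (adj G) s -> v \notin s ->
  u \in s -> w \in s -> adj G v u -> adj G v w -> u = w.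
Proof.
move=> acyc gs vs us ws avu avw; apply/eqP; apply: contraT => uw.
have /connectP[p pp lw] := grown_connect (@adj_sym _ G) gs us ws.
case/shortenP: pp lw => q pq uq _ lw.
have qs : {subset q <= s}.
  elim: (q) (u) pq => //= a q' IH u' /andP[/and3P[_ sa _] pq] x.
  by rewrite inE => /orP[/eqP ->//|]; exact: (IH a).
have pq' : path (adj G) u q.
  by apply: sub_path pq => a b /= /and3P[].
case: (acyc [:: v, u & q]).
  (* The path [q] is nonempty because [u != w], so the cycle has more than two vertices. *)
  by case: (q) lw uw => //= e; rewrite e eqxx.
apply/andP; split; last first.
  rewrite cons_uniq uq andbT inE negb_or; apply/andP; split.
    by apply: contraNneq vs => ->.
  by apply: contra vs => /qs.
by rewrite /= avu rcons_path pq' -lw adj_sym.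
Qed.

Lemma inner_grown_cons (V : finType) (G : sgraph V) (s : seq V) (v u : V) :
  acyclic_graph G -> grown (adj G) s -> v \notin s -> u \in s -> adj G v u ->
  inner G [set x in v :: s] =
    ([set v; u] |: inner G [set x in s])%SET.
Proof.
move=> acyc gs vs us avu; apply/setP => e; rewrite !inE.
apply/andP/orP => [[eG es]|[/eqP ->|/andP[eG es]]].
- have [ve|ve] := boolP (v \in e); last first.
    right; rewrite eG /=; apply/subsetP => x xe.
    move/subsetP/(_ x xe): es; rewrite !inE => /orP[/eqP xv|//].
    by rewrite -xv xe in ve.
  left; have [x [y [xy exy]]] := edge_ends eG.
  wlog vx : x y xy exy / v = x.
    move=> th; move: (ve); rewrite exy !inE => /orP[/eqP vx|/eqP vy].
      by have := th x y xy exy vx; rewrite -exy.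
    have yx : y != x by rewrite eq_sym.
    by have := th y x yx; rewrite [[set y; x]%SET]setUC -exy; apply.
  subst x; rewrite exy; apply/eqP; congr [set _; _]%SET.
  apply: (grown_parent_uniq acyc gs vs) => //; last by rewrite /adj -exy.
  move/subsetP/(_ y): es; rewrite exy !inE eqxx orbT => /(_ isT).
  by rewrite eq_sym (negPf xy).
- split; first exact: avu.
  by apply/subsetP => x; rewrite !inE => /orP[->//|/eqP ->]; rewrite us orbT.
- split=> //; apply: (subset_trans es).
  by apply/subsetP => x; rewrite !inE => ->; rewrite orbT.
Qed.

(* A new vertex is placed immediately after its unique neighbour, so that no
   vertex lies under the new arc. *)
Lemma grown_layout (V : finType) (G : sgraph V) (s : seq V) :
  acyclic_graph G -> grown (adj G) s ->
  #|inner G [set x in s]|.+1 = size s /\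
  exists pos : V -> nat, {in s &, injective pos} /\
    noncrossing pos (inner G [set x in s]).
Proof.
move=> acyc; elim: s => //= v s IH /orP[/eqP ->|/and3P[vs /hasP[u us avu] gs]].
  have i0 : inner G [set x in [:: v]] = set0%SET.
    apply/setP => e; rewrite !inE; apply/negbTE/negP => /andP[/card_edge c2].
    by move/subset_leq_card; rewrite c2 set_cons set_nil setU0 cards1.
  rewrite i0 cards0; split=> //; exists (fun=> 0%N); split; last by [].
  by move=> x y; rewrite !inE => /eqP -> /eqP ->.
rewrite (inner_grown_cons acyc gs vs us avu).
have [c [pos [pi pn]]] := IH gs.
have nvu : [set v; u]%SET \notin inner G [set x in s].
  rewrite inE negb_and; apply/orP; right; apply/subsetPn; exists v.
    by rewrite !inE eqxx.
  by rewrite inE.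
rewrite cardsU1 nvu add1n c; split=> //.
(* Doubling frees the odd positions. Only [v] takes one, so parity gives injectivity, and no
   position lies strictly between the ends of the new arc. *)
pose pos' x := if x == v then (pos u).*2.+1 else (pos x).*2.
have pv : pos' v = (pos u).*2.+1 by rewrite /pos' eqxx.
have ps x : x \in s -> pos' x = (pos x).*2.
  by move=> xs; rewrite /pos'; case: eqP xs vs => // -> ->.
exists pos'; split.
  move=> x y; rewrite !inE => /orP[/eqP ->|xs] /orP[/eqP ->|ys]; rewrite ?pv ?ps//.
  - by move=> e; have := congr1 odd e; rewrite /= !odd_double.
  - by move=> e; have := congr1 odd e; rewrite /= !odd_double.
  - by move/double_inj; exact: pi.
have new a b : [set a; b]%SET = [set v; u]%SET ->
    (pos' a = (pos u).*2.+1 /\ pos' b = (pos u).*2) \/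
    (pos' b = (pos u).*2.+1 /\ pos' a = (pos u).*2).
  move=> e; have ab : a \in [set v; u]%SET /\ b \in [set v; u]%SET.
    by rewrite -e !inE !eqxx orbT.
  have vu : v \in [set a; b]%SET /\ u \in [set a; b]%SET.
    by rewrite e !inE !eqxx orbT.
  have nvu' : v != u by apply: contraNneq vs => ->.
  rewrite -pv -(ps u) //; move: ab vu; rewrite !inE.
  move=> [/orP[]/eqP -> /orP[]/eqP ->]; rewrite ?eqxx ?orbb ?(negPf nvu') ; auto.
  - by rewrite eq_sym (negPf nvu') => -[].
  - by case.
have old a b : [set a; b]%SET \in inner G [set x in s] ->
    pos' a = (pos a).*2 /\ pos' b = (pos b).*2.
  rewrite inE => /andP[_ /subsetP ab]; split; apply: ps.
    by have := ab a; rewrite !inE eqxx => /(_ isT).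
  by have := ab b; rewrite !inE eqxx orbT => /(_ isT).
move=> a b c' d /setU1P[/new ab|abE] /setU1P[/new cd|cdE].
- by lia.
- by have [? ?] := old _ _ cdE; lia.
- by have [? ?] := old _ _ abE; lia.
- have [-> ->] := old _ _ abE; have [-> ->] := old _ _ cdE.
  by rewrite !ltn_double; exact: pn abE cdE.
Qed.

Lemma inner_setT (V : finType) (G : sgraph V) : inner G [set: V]%SET = edges G.
Proof. by apply/setP => e; rewrite inE subsetT andbT. Qed.

(** A tree is grown from any of its vertices. The edge count serves to keep the number of edges
    under a switch, the layout to draw the new copy of [H]. *)
Lemma tree_layout (V : finType) (G : sgraph V) : is_tree G ->
  #|edges G|.+1 = #|V| /\
  exists pos : V -> nat, injective pos /\ noncrossing pos (edges G).
Proof.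
move=> [[V0 cG] acyc]; have /card_gt0P[x _] := V0.
have [s gs sx] := grown_span x (@adj_sym _ G).
have sT : [set y in s]%SET = [set: V]%SET.
  by apply/setP => y; rewrite !inE sx; exact: cG.
have [] := grown_layout acyc gs; rewrite sT inner_setT => -> [pos [pi pn]].
split.
  by rewrite -(card_uniqP (grown_uniq gs)) -cardsT -sT cardsE.
exists pos; split=> // a b; apply: pi; rewrite sx; exact: cG.
Qed.

(** A component contains a spanning tree. *)
Lemma comp_edges (V : finType) (G : sgraph V) (x : V) :
  (#|comp_of G x| <= #|inner G (comp_of G x)|.+1)%N.
Proof.
have [s gs sx] := grown_span x (@adj_sym _ G).
have e : comp_of G x = [set y in s]%SET by apply/setP => y; rewrite !inE sx.
by rewrite e (leq_trans _ (inner_grown_ge gs)) // cardsE (card_uniqP (grown_uniq gs)).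
Qed.

(** * Planarity: new trees drawn beside an existing drawing *)

(** If one interval contains the other and differs from it, its arch is strictly higher over the
    inner one. Hence arches that meet are equal or have interleaved ends. *)
Lemma arches_meet (R : realDomainType) (a b c d x : R) :
  a < x -> x < b -> c < x -> x < d -> (x - a) * (b - x) = (x - c) * (d - x) ->
  [\/ a = c /\ b = d, a < c /\ c < b /\ b < d | c < a /\ a < d /\ d < b].
Proof.
move=> ax xb cx xd e.
have [ac|ca|ac] := ltgtP a c.
- have [bd|db] := ltP b d; first by constructor 2; split=> //; split=> //; lra.
  by exfalso; nra.
- have [db|bd] := ltP d b; first by constructor 3; split=> //; split=> //; lra.
  by exfalso; nra.
- constructor 1; split=> //; move: e; rewrite ac.
  have xc : x - c != 0 by lra.
  by move/(mulfI xc); lra.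
Qed.

Lemma arc_bounded (R : realType) (g : R -> R * R) :
  ({within `[0, 1], continuous g})%classic ->
  exists M, forall t, t \in `[0, 1] -> (g t).1 <= M.
Proof.
move=> cg.
have cf : ({within `[0, 1], continuous (fst \o g)})%classic.
  by move=> t; apply: (@cvg_comp _ _ _ g fst _ (nbhs (g t))); [exact: cg|exact: cvg_fst].
have [c _ h] := EVT_max ler01 cf.
by exists ((g c).1) => t t01; exact: h.
Qed.

(* A rotated parabola over the segment between the abscissas [a] and [b]: at
   abscissa [x] its height is [(x - a) * (b - x)]. *)
Definition arch (R : realType) (a b : R) (t : R) : R * R :=
  (a + (b - a) * t, (b - a) ^+ 2 * (t * (1 - t))).

Lemma arch_height (R : realType) (a b t : R) :
  (arch a b t).2 = ((arch a b t).1 - a) * (b - (arch a b t).1).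
Proof. rewrite /arch /=; ring. Qed.

Lemma arch_continuous (R : realType) (a b : R) : continuous (arch a b).
Proof.
move=> t; apply: (@cvg_pair _ _ _ (nbhs t) (nbhs (arch a b t).1) (nbhs (arch a b t).2)) => /=.
  by apply: cvgD; [exact: cvg_cst|apply: cvgM; [exact: cvg_cst|exact: cvg_id]].
apply: cvgM; first exact: cvg_cst.
apply: cvgM; first exact: cvg_id.
by apply: cvgB; [exact: cvg_cst|exact: cvg_id].
Qed.

(** The old drawing lies to the left of a vertical line. The vertices of [S] are moved to the
    horizontal axis to the right of that line, in the order given by [pos], and the edges inside [S]
    become arches over the axis; everything else is kept. *)
Lemma planar_layout (R : realType) (V : finType) (G G' : sgraph V)
    (S : {set V}) (pos : V -> nat) :
  planar R G ->
  (forall e, e \in edges G' ->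
     (e \in edges G /\ [disjoint e & S]) \/ e \subset S) ->
  {in S &, injective pos} -> noncrossing pos (inner G' S) -> planar R G'.
Proof.
move=> [pt [arc dr]] G'E posI posN.
(* The ends of each edge inside [S] are ordered by position, so that its arch runs from left to
   right; the value [(0, 0)] elsewhere is arbitrary. *)
have [ab abE] : {ab : {set V} -> nat * nat & forall e, e \in inner G' S ->
    exists x y, [/\ e = [set x; y]%SET, x \in S, y \in S,
      ab e = (pos x, pos y) & (pos x < pos y)%N]}.
  apply: (@boolp.choice _ _ (fun e (p : nat * nat) => e \in inner G' S ->
    exists x y, [/\ e = [set x; y]%SET, x \in S, y \in S,
      p = (pos x, pos y) & (pos x < pos y)%N])) => e.
  have [eG|neG] := boolP (e \in inner G' S); last by exists (0, 0)%N.
  move: eG; rewrite inE => /andP[eG eS].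
  have [x [y [xy exy]]] := edge_ends eG.
  have xS : x \in S by apply: (subsetP eS); rewrite exy !inE eqxx.
  have yS : y \in S by apply: (subsetP eS); rewrite exy !inE eqxx orbT.
  have [lt|gt|eq] := ltngtP (pos x) (pos y).
  - by exists (pos x, pos y) => _; exists x, y; split.
  - by exists (pos y, pos x) => _; exists y, x; split; rewrite // finset.setUC.
  - by rewrite (posI _ _ xS yS eq) eqxx in xy.
have [Me MeE] : {Me : {set V} -> R & forall e, e \in edges G ->
    forall t, t \in `[0, 1] -> (arc e t).1 <= Me e}.
  apply: (@boolp.choice _ _ (fun e M => e \in edges G ->
    forall t, t \in `[0, 1] -> (arc e t).1 <= M)) => e.
  have [eG|neG] := boolP (e \in edges G); last by exists 0.
  have [M HM] := arc_bounded (drawing_arc_continuous dr eG).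
  by exists M.
have norm_le_sum (I : finType) (f : I -> R) i : `|f i| <= \sum_j `|f j|.
  by rewrite (bigD1 i) //= lerDl sumr_ge0.
(* The sums dominate each bound separately, and the summand 1 makes the inequalities strict. *)
pose M : R := \sum_e `|Me e| + \sum_v `|(pt v).1| + 1.
have arcM e t : e \in edges G -> t \in `[0, 1] -> (arc e t).1 < M.
  move=> eG t01; apply: (le_lt_trans (MeE e eG t t01)).
  apply: (le_lt_trans (ler_norm _)).
  have := norm_le_sum _ Me e; have : 0 <= \sum_v `|(pt v).1| by rewrite sumr_ge0.
  by rewrite /M; lra.
have ptM v : (pt v).1 < M.
  apply: (le_lt_trans (ler_norm _)).
  have := norm_le_sum _ (fun v => (pt v).1) v.
  have : 0 <= \sum_e `|Me e| by rewrite sumr_ge0.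
  by rewrite /M /=; lra.
pose q x : R := M + (pos x)%:R.
have qM x : M <= q x by rewrite lerDl.
have q_lt x y : (q x < q y) = (pos x < pos y)%N by rewrite ltrD2l ltr_nat.
have qI x y : x \in S -> y \in S -> q x = q y -> x = y.
  move=> xS yS /addrI /eqP; rewrite eqr_nat => /eqP; exact: posI.
pose pt' v := if v \in S then (q v, 0) else pt v.
pose arc' (e : {set V}) := if e \subset S then arch (M + (ab e).1%:R) (M + (ab e).2%:R)
               else arc e.
have caseE e : e \in edges G' ->
    (exists x y, [/\ e = [set x; y]%SET, x \in S, y \in S,
      q x < q y & forall t, arc' e t = arch (q x) (q y) t]) /\ e \in inner G' S \/
    [/\ e \in edges G, [disjoint e & S] & arc' e = arc e].
  move=> eG'; have [eS|neS] := boolP (e \subset S).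
    have ei : e \in inner G' S by rewrite inE eG'.
    left; split=> //; have [x [y [exy xS yS abe lt]]] := abE e ei.
    by exists x, y; split; rewrite // ?q_lt// /arc' eS abe.
  case: (G'E e eG') => [[eG dS]|]; last by rewrite (negPf neS).
  by right; split=> //; rewrite /arc' (negPf neS).
have arch1 (a b t : R) : a < b -> t \in `]0, 1[ ->
    a < (arch a b t).1 /\ (arch a b t).1 < b.
  by rewrite in_itv /= => lt /andP[t0 t1]; split; rewrite /arch/=; nra.
have oc (t : R) : t \in `]0, 1[ -> t \in `[0, 1].
  by rewrite !in_itv /= => /andP[t0 t1]; rewrite !ltW.
exists pt', arc'; split.
- move=> x y; rewrite /pt'; case: ifP => xS; case: ifP => yS.
  + by case; exact: qI.
  + by move=> e; have := ptM y; rewrite -e ltNge qM.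
  + by move=> e; have := ptM x; rewrite e ltNge qM.
  + exact: (drawing_pt_inj dr).
- move=> e /caseE[[[x [y [_ _ _ _ aE]]] _]|[eG _ ->]]; last first.
    exact: (drawing_arc_continuous dr).
  rewrite (_ : arc' e = arch (q x) (q y)); last exact: funext.
  by apply: continuous_subspaceT; exact: arch_continuous.
- move=> e /caseE[[[x [y [_ _ _ lt aE]]] _]|[eG _ ->]]; last first.
    exact: (drawing_arc_simple dr).
  move=> s t _ _; rewrite !aE => -[/addrI + _].
  by apply: mulfI; rewrite subr_eq0 gt_eqF.
- move=> e /caseE[[[x [y [-> xS yS lt aE]]] _]|[eG dS ->]].
    exists x, y; rewrite !aE /pt' xS yS /arch; split=> //; congr (_, _); ring.
  have [x [y [exy a0 a1]]] := drawing_arc_ends dr eG.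
  exists x, y; rewrite /pt' a0 a1; split=> //.
    by rewrite (disjointFr dS) // exy !inE eqxx.
  by rewrite (disjointFr dS) // exy !inE eqxx orbT.
- move=> e /caseE[[[x [y [-> xS yS lt aE]]] _]|[eG dS ->]] t v t01.
    have [lx xl] := arch1 _ _ _ lt t01.
    rewrite aE /pt'; case: ifP => vS eq; last first.
      by have := ptM v; rewrite -eq ltNge (le_trans (qM x)) // ltW.
    (* A moved vertex has height 0, whereas an arch has height 0 only at its ends. *)
    have := arch_height (q x) (q y) t; rewrite eq /= => /eqP.
    rewrite eq_sym mulf_eq0 !subr_eq0; move: lx xl; rewrite eq /= => lx xl.
    by rewrite !gt_eqF.
  rewrite /pt'; case: ifP => vS; last exact: (drawing_arc_pt dr).
  by move=> eq; have := arcM e t eG (oc _ t01); rewrite eq ltNge qM.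
- move=> e e' /caseE[[[x [y [exy xS yS lt aE]]] ei]|[eG dS ->]]
            /caseE[[[x' [y' [exy' xS' yS' lt' aE']]] ei']|[eG' dS' ->]] nee s t s01 t01.
  + rewrite aE aE' => eq.
    have [l1 l2] := arch1 _ _ _ lt s01; have [l1' l2'] := arch1 _ _ _ lt' t01.
    have := arch_height (q x) (q y) s; have := arch_height (q x') (q y') t.
    move: l1 l2; rewrite eq => l1 l2 -> /esym h.
    case: (arches_meet l1 l2 l1' l2' h) => [[/qI xx /qI yy]|[]|[]].
    * by move/eqP: nee; apply; rewrite exy exy' xx // yy.
    * rewrite !q_lt => h1 [h2 h3]; apply: (posN x y x' y') => //; first by rewrite -exy.
      by rewrite -exy'.
    * rewrite !q_lt => h1 [h2 h3]; apply: (posN x' y' x y) => //; first by rewrite -exy'.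
      by rewrite -exy.
  + rewrite aE => eq; have [l1 l2] := arch1 _ _ _ lt s01.
    have := arcM e' t eG' (oc _ t01); rewrite -eq ltNge => /negP; apply.
    by rewrite (le_trans (qM x)) // ltW.
  + rewrite aE' => eq; have [l1 l2] := arch1 _ _ _ lt' t01.
    have := arcM e s eG (oc _ s01); rewrite eq ltNge => /negP; apply.
    by rewrite (le_trans (qM x')) // ltW.
  + exact: (drawing_arc_disjoint dr).
Qed.

(** * Components, and the abundance of small tree components *)

Lemma comp_refl (V : finType) (G : sgraph V) (x : V) : x \in comp_of G x.
Proof. by rewrite inE connect0. Qed.

Lemma comp_eq (V : finType) (G : sgraph V) (x y : V) :
  y \in comp_of G x -> comp_of G y = comp_of G x.
Proof.
rewrite inE => xy; apply/setP => z; rewrite !inE.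
by rewrite (same_connect (@connect_adj_sym _ G) xy).
Qed.

Lemma componentsP (V : finType) (G : sgraph V) (C : {set V}) :
  reflect (exists x, C = comp_of G x) (C \in components G).
Proof.
have e x : [set y in [set: V] | connect (adj G) x y]%SET = comp_of G x.
  by apply/setP => y; rewrite !inE.
apply: (iffP imsetP) => [[x _ ->]|[x ->]]; first by exists x; rewrite e.
by exists x; rewrite // e.
Qed.

Lemma component_eq (V : finType) (G : sgraph V) (C : {set V}) (x : V) :
  C \in components G -> x \in C -> C = comp_of G x.
Proof. by move=> /componentsP[y ->] /comp_eq. Qed.

Lemma trivIset_components (V : finType) (G : sgraph V) (P : {set {set V}}) :
  P \subset components G -> trivIset P.
Proof.
move=> /subsetP PG; apply/trivIsetP => C C' /PG CG /PG C'G; apply: contraNT.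
case/pred0Pn => x /= /andP[xC xC'].
by rewrite (component_eq CG xC) (component_eq C'G xC').
Qed.

Lemma edge_sub_comp (V : finType) (G : sgraph V) (e : {set V}) (x : V) :
  e \in edges G -> x \in e -> e \subset comp_of G x.
Proof.
move=> eG xe; have [a [b [ab eab]]] := edge_ends eG.
have cab : connect (adj G) a b by apply: connect1; rewrite /adj -eab.
have cba : connect (adj G) b a by rewrite connect_adj_sym.
move: xe; rewrite eab !inE => xe; apply/subsetP => y; rewrite !inE.
by case/orP: xe => /eqP ->; case/orP => /eqP ->; rewrite ?connect0.
Qed.

Lemma edge_cover (V : finType) (G : sgraph V) (P : {set {set V}}) (e : {set V}) :
  P \subset components G -> e \in edges G ->
  [disjoint e & cover P] \/ e \subset cover P.
Proof.
move=> /subsetP PG eG; have [/pred0P e0|] := boolP [disjoint e & cover P]; first by left.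
case/pred0Pn => x /= /andP[xe /bigcupP[C CP xC]]; right.
apply: subset_trans (edge_sub_comp eG xe) _.
by rewrite -(component_eq (PG _ CP) xC) bigcup_sup.
Qed.

Lemma card_set_sum (T : finType) (A : {set T}) (P : pred T) :
  #|[set x in A | P x]| = (\sum_(x in A) P x)%N.
Proof.
rewrite -sum1_card (eq_bigl (fun x => (x \in A) && P x)) => [|x]; last by rewrite inE.
by rewrite big_mkcondr; apply: eq_bigr => x _; case: (P x).
Qed.

(** An edge inside the union lies in exactly one of the components; the incidences are counted edge
    by edge. *)
Lemma card_inner_cover (V : finType) (G : sgraph V) (P : {set {set V}}) :
  P \subset components G ->
  #|inner G (cover P)| = (\sum_(C in P) #|inner G C|)%N.
Proof.
move=> PG; have cardI C : #|inner G C| = (\sum_(e in edges G) (e \subset C))%N.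
  exact: card_set_sum.
under eq_bigr do rewrite cardI.
rewrite cardI exchange_big /=; apply: eq_bigr => e eG.
have [x xe] : exists x, x \in e.
  by apply/set0Pn; rewrite -card_gt0 (card_edge eG).
have [/subsetP eP|neP] := boolP (e \subset cover P).
  have /bigcupP[C CP xC] := eP x xe.
  rewrite (bigD1 C) //= (component_eq (subsetP PG _ CP) xC) edge_sub_comp //.
  rewrite big1 // => C' /andP[C'P nC]; apply/eqP; rewrite eqb0.
  apply: contra nC => /subsetP/(_ x xe) xC'.
  by rewrite (component_eq (subsetP PG _ C'P) xC').
rewrite big1 // => C CP; apply/eqP; rewrite eqb0; apply: contra neP => eC.
by apply: subset_trans eC _; exact: bigcup_sup.
Qed.

Lemma cover_components (V : finType) (G : sgraph V) :
  cover (components G) = [set: V]%SET.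
Proof.
apply/setP => x; rewrite inE; apply/bigcupP; exists (comp_of G x); last exact: comp_refl.
by apply/componentsP; exists x.
Qed.

(** By [comp_edges], a component with fewer edges than vertices has exactly one edge less, which
    makes it a tree. *)
Definition small_trees (V : finType) (G : sgraph V) (K : nat) : {set {set V}} :=
  [set C in components G | (#|inner G C| < #|C|)%N && (#|C| <= K)%N].

(** Vertices minus edges, summed over the components, is at most the number of tree components, of
    which at most [#|V| / K] have more than [K] vertices. The inequality is multiplied by [K] to
    stay in [nat]. *)
Lemma many_small_trees (V : finType) (G : sgraph V) (K : nat) :
  (K * #|V| <= K * (#|edges G| + #|small_trees G K|) + #|V|)%N.
Proof.
set T := small_trees G K.
pose B := [set C in components G | (K < #|C|)%N].
have cT := eqP (trivIset_components (subxx (components G))).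
have VE : #|V| = (\sum_(C in components G) #|C|)%N.
  by rewrite cT cover_components cardsT.
have EE : #|edges G| = (\sum_(C in components G) #|inner G C|)%N.
  by rewrite -(card_inner_cover (subxx _)) cover_components inner_setT.
have KB : (K * #|B| <= #|V|)%N.
  rewrite VE card_set_sum big_distrr /=; apply: leq_sum => C _.
  by case: ltnP; rewrite ?muln0 ?muln1 // => /ltnW.
suff : (#|V| <= #|edges G| + #|T| + #|B|)%N.
  by move=> h; apply: leq_trans (leq_mul (leqnn K) h) _; rewrite mulnDr leq_add2l.
rewrite VE EE !card_set_sum -!big_split /=; apply: leq_sum => C /componentsP[x ->].
have := comp_edges G x; rewrite (leqNgt _ K).
by case: ltnP => /=; case: (K < _)%N => /=; lia.
Qed.

Lemma comp_closed (V : finType) (G : sgraph V) (S : {set V}) (x : V) :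
  x \in S -> (forall a b, a \in S -> adj G a b -> b \in S) ->
  (forall y, y \in S -> connect (adj G) x y) -> comp_of G x = S.
Proof.
move=> xS cl cS; apply/setP => y; rewrite inE; apply/idP/idP; last exact: cS.
have c : fingraph.closed (adj G) (mem S).
  by apply: (intro_closed (@connect_adj_sym _ G)) => a b ab aS; exact: cl ab.
by move=> xy; rewrite -(closed_connect c xy).
Qed.

(* A component of [G'] that avoids [Z] is a component of [G]. *)
Lemma num_components_iso_switch (V W : finType) (G G' : sgraph V) (H : sgraph W)
    (Z : {set V}) :
  (forall e, (e \in edges G) != (e \in edges G') -> e \subset Z) ->
  (num_components_iso G' H <= num_components_iso G H + #|Z|)%N.
Proof.
move=> GG'; rewrite /num_components_iso.
set X' := [set C in components G' | _]; set X := [set C in components G | _].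
have eqe (e : {set V}) x : x \in e -> x \notin Z -> (e \in edges G) = (e \in edges G').
  move=> xe xZ; apply/eqP; apply: contraNT xZ => /GG' /subsetP; exact.
have dis C : C \in X' -> [disjoint C & Z] -> C \in X.
  rewrite !inE => /andP[CG' iC] dCZ.
  have nZ x : x \in C -> x \notin Z by move=> xC; rewrite (disjointFr dCZ).
  have adjE x y : x \in C -> adj G x y = adj G' x y.
    by move=> xC; rewrite /adj (eqe _ x) ?nZ // !inE eqxx.
  apply/andP; split; last first.
    case/existsP: iC => f /and3P[fi /eqP fC /forallP fa]; apply/existsP; exists f.
    rewrite fi fC eqxx /=; apply/forallP => x; apply/forallP => y.
    rewrite adjE; last by rewrite -fC imset_f.
    exact: (forallP (fa x)).
  case/componentsP: (CG') => x Cx; have xC : x \in C by rewrite Cx comp_refl.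
  have cl a b : a \in C -> adj G' a b -> b \in C.
    rewrite Cx !inE => xa ab; apply: connect_trans xa _; exact: connect1.
  apply/componentsP; exists x; apply/esym/comp_closed => //.
    by move=> a b aC; rewrite adjE //; exact: cl.
  move=> y; rewrite Cx inE => /connectP[p pp ->].
  elim: p (x) xC pp => [|b p IH] a aC //= /andP[ab pb].
  apply: connect_trans (IH b (cl _ _ aC ab) pb).
  by apply: connect1; rewrite adjE.
rewrite -(cardsID X X'); apply: leq_add; first by apply: subset_leq_card; exact: subsetIr.
(* Each new copy of [H] meets [Z]. Picking one common vertex is injective, since distinct components
   are disjoint. *)
have /card_in_imset <- : {in X' :\: X &, injective (fun C => [pick x in C :&: Z]%SET)}.
  move=> C C'; rewrite !in_setD => /andP[nC CX] /andP[nC' CX'].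
  case: pickP => [x|n]; last first.
    by case/negP: nC; apply: dis => //; apply/pred0P => x; rewrite /= -in_setI n.
  rewrite inE => /andP[xC _]; case: pickP => // y + [xy]; rewrite -xy inE => /andP[xC' _].
  move: CX CX'; rewrite !inE => /andP[CG _] /andP[CG' _].
  by rewrite (component_eq CG xC) (component_eq CG' xC').
have SI : injective (@Some V) by move=> x y [].
rewrite -(card_imset Z SI); apply: subset_leq_card; apply/subsetP => z /imsetP[C].
rewrite in_setD => /andP[nC CX] ->; case: pickP => [x|n].
  by rewrite inE => /andP[_ xZ]; exact: imset_f.
by case/negP: nC; apply: dis => //; apply/pred0P => x; rewrite /= -in_setI n.
Qed.

Lemma card_iso_comps (V W : finType) (G : sgraph V) (H : sgraph W) :
  (#|[set v | induced_iso G (comp_of G v) H]| <= num_components_iso G H * #|W|)%N.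
Proof.
set X := [set C in components G | induced_iso G C H].
apply: (@leq_trans #|cover X|).
  apply: subset_leq_card; apply/subsetP => v; rewrite inE => iv.
  apply/bigcupP; exists (comp_of G v); last exact: comp_refl.
  by rewrite inE iv andbT; apply/componentsP; exists v.
apply: leq_trans (leq_card_cover X) _.
rewrite /num_components_iso -/X -sum_nat_const; apply: leq_sum => C.
rewrite inE => /andP[_ /existsP[f /and3P[/injectiveP fi /eqP <- _]]].
by rewrite card_imset // cardsT.
Qed.

(** * The switch *)

Lemma sgraph_of_edges (V : finType) (E : {set {set V}}) :
  (forall e, e \in E -> #|e| = 2) -> exists G : sgraph V, edges G = E.
Proof.
move=> E2; have h : [forall e in E, #|e| == 2%N].
  by apply/forallP => e; apply/implyP => /E2 ->.
by exists (SGraph h).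
Qed.

Definition star (V : finType) (S : {set V}) (x : V) : {set {set V}} :=
  [set [set x; y]%SET | y in S :\ x].

Lemma starP (V : finType) (S : {set V}) (x : V) (e : {set V}) :
  reflect (exists y, [/\ y != x, y \in S & e = [set x; y]%SET]) (e \in star S x).
Proof.
apply: (iffP imsetP) => [[y]|[y [yx yS ->]]].
  by rewrite !inE => /andP[yx yS] ->; exists y.
by exists y; rewrite // !inE yx.
Qed.

Lemma card_star (V : finType) (S : {set V}) (x : V) : x \in S ->
  #|star S x|.+1 = #|S|.
Proof.
move=> xS; rewrite card_in_imset ?(cardsD1 x S) ?xS // => y z.
rewrite !inE => /andP[yx _] /andP[zx _] /setP/(_ y).
by rewrite !inE eqxx orbT (negPf yx) => /esym/eqP.
Qed.

Lemma embed_in_set (V W : finType) (S : {set V}) : (#|W| <= #|S|)%N ->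
  exists f : W -> V, injective f /\ forall w, f w \in S.
Proof.
move=> WS; exists (fun w => enum_val (widen_ord WS (enum_rank w))); split.
  by move=> x y /enum_val_inj/(congr1 val)/= /val_inj/enum_rank_inj.
by move=> w; exact: enum_valP.
Qed.

Lemma imset_set2 (V W : finType) (f : W -> V) (x y : W) :
  f @: [set x; y]%SET = [set f x; f y]%SET.
Proof. by rewrite imsetU !imset_set1. Qed.

(** With [h = #|W|], the edges inside [S] number [#|S| - h - 1] and those of [D] number [h - 1]. The
    copy of [H] has [h - 1] edges and the star on the other [#|S| - h] vertices has [#|S| - h - 1],
    so the total is kept. The last two conclusions make the switch reversible. *)
Lemma tree_switch (R : realType) (V W : finType) (G : sgraph V) (H : sgraph W)
    (S : {set V}) (D : {set {set V}}) :
  is_tree H -> planar R G ->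
  (forall e, e \in edges G -> [disjoint e & S] \/ e \subset S) ->
  (#|inner G S| + #|W|.+1 = #|S|)%N ->
  D \subset edges G :\: inner G S -> #|D|.+1 = #|W| ->
  exists (G' : sgraph V) (v1 v2 : V),
    [/\ planar R G', #|edges G'| = #|edges G|,
        induced_iso G' (comp_of G' v1) H,
        S = (comp_of G' v1 :|: comp_of G' v2)%SET &
        forall e : {set V}, ~~ (e \subset S) ->
          (e \in edges G') = (e \in edges G) && (e \notin D)].
Proof.
move=> treeH plG clS cS /subsetP DG cD.
have [cH [posH [posHi posHn]]] := tree_layout treeH.
have WS : (#|W| < #|S|)%N by rewrite -cS addnS ltnS leq_addl.
have [f [fi fS]] := embed_in_set (ltnW WS).
pose S1 := f @: [set: W]%SET.
have cS1 : #|S1| = #|W| by rewrite card_imset // cardsT.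
have S1S : S1 \subset S by apply/subsetP => _ /imsetP[w _ ->].
pose S2 := S :\: S1.
have cS2 : #|S2| = (#|S| - #|W|)%N by rewrite cardsD (setIidPr S1S) cS1.
have [x2 x2S2] : exists x, x \in S2 by apply/card_gt0P; rewrite cS2 subn_gt0.
have S12 : [disjoint S1 & S2]
  by rewrite disjoint_sym disjoints_subset; apply/subsetP => x; rewrite !inE => /andP[].
pose E0 := (edges G :\: inner G S) :\: D.
pose F1 := [set f @: (e : {set W}) | e in edges H]%SET.
pose F2 := star S2 x2.
have E0P e : e \in E0 -> [/\ e \in edges G, e \notin D & [disjoint e & S]].
  rewrite !inE negb_and => /and3P[eD /orP[/negP//|neS] eG]; split=> //.
  by case: (clS e eG) => //; rewrite (negPf neS).
have F1S e : e \in F1 -> e \subset S1.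
  by case/imsetP => e' _ ->; apply: imsetS; exact: subsetT.
have F2S e : e \in F2 -> e \subset S2.
  case/starP => y [_ yS ->]; apply/subsetP => z.
  by case/set2P => ->.
have ne2 (e A : {set V}) : #|e| = 2 -> [disjoint e & A] -> e \subset A -> False.
  move=> c2 dA eA; have : e \subset finset.set0.
    by rewrite -(disjoint_setI0 dA) subsetI subxx.
  by rewrite subset0 => /eqP e0; rewrite e0 cards0 in c2.
have F1_2 e : e \in F1 -> #|e| = 2.
  by case/imsetP => e' e'H ->; rewrite card_imset // (card_edge e'H).
have F2_2 e : e \in F2 -> #|e| = 2.
  by case/starP => y [yx yS ->]; rewrite cards2 eq_sym yx.
have E0_2 e : e \in E0 -> #|e| = 2 by case/E0P => /card_edge.
(* The trees are drawn in two stages, one use of [planar_layout] for each: first the copy of [H] on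
   [S1], then the star on [S2]. *)
have [G1 G1E] : exists G1 : sgraph V, edges G1 = E0 :|: F1.
  by apply: sgraph_of_edges => e /setUP[/E0_2|/F1_2].
have [G' G'E] : exists G' : sgraph V, edges G' = E0 :|: F1 :|: F2.
  by apply: sgraph_of_edges => e /setUP[/setUP[/E0_2|/F1_2]|/F2_2].
have disS (A B C : {set V}) : [disjoint A & B] -> C \subset B -> [disjoint A & C].
  by move=> dAB CB; rewrite disjoint_sym; apply: disjointWl CB _; rewrite disjoint_sym.
have S2S : S2 \subset S by exact: subsetDl.
have plG1 : planar R G1.
  pose pos x := if [pick w | f w == x] is Some w then posH w else 0%N.
  have posf w : pos (f w) = posH w.
    rewrite /pos; case: pickP => [w' /eqP/fi -> //|/(_ w)].
    by rewrite eqxx.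
  apply: (@planar_layout R V G G1 S1 pos plG).
  - move=> e; rewrite G1E => /setUP[/E0P[eG _ eS]|/F1S]; last by right.
    by left; split=> //; exact: disS S1S.
  - move=> _ _ /imsetP[a _ ->] /imsetP[b _ ->]; rewrite !posf => /posHi -> //.
  - have inF1 a b : [set a; b]%SET \in inner G1 S1 -> exists a' b',
        [/\ a = f a', b = f b' & [set a'; b']%SET \in edges H].
      rewrite inE G1E => /andP[/setUP abE abS1].
      have /imsetP[a' _ Ea] : a \in S1 by apply: (subsetP abS1); rewrite !inE eqxx.
      have /imsetP[b' _ Eb] : b \in S1 by apply: (subsetP abS1); rewrite !inE eqxx orbT.
      exists a', b'; split=> //; case: abE => [abE0|/imsetP[e eH]].
        case: (ne2 _ _ (E0_2 _ abE0) _ (subset_trans abS1 S1S)).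
        by case: (E0P _ abE0).
      by rewrite Ea Eb -imset_set2 => /(imset_inj fi) ->.
    move=> a b c d /inF1[a' [b' [-> -> abH]]] /inF1[c' [d' [-> -> cdH]]].
    by rewrite !posf; exact: posHn.
have E0F1 e : e \in E0 :|: F1 -> [disjoint e & S2].
  case/setUP => [/E0P[_ _ eS]|/F1S eS1]; first exact: disS S2S.
  by apply: disjointWl eS1 _.
have plG' : planar R G'.
  apply: (@planar_layout R V G1 G' S2 (fun x => enum_rank x) plG1).
  - move=> e; rewrite G'E => /setUP[eG1|/F2S]; last by right.
    by left; split; [rewrite G1E|exact: E0F1].
  - by move=> x y _ _ /val_inj/enum_rank_inj.
  (* Any injective position suits a star: two edges share [x2], so their ends cannot interleave
     strictly. *)
  - have inF2 a b : [set a; b]%SET \in inner G' S2 -> a = x2 \/ b = x2.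
      rewrite inE G'E => /andP[/setUP[abE|/starP[y [_ _ e]]] abS2].
        have ab2 : #|[set a; b]%SET| = 2 by case/setUP: abE => [/E0_2|/F1_2].
        by case: (ne2 _ _ ab2 (E0F1 _ abE) abS2).
      have : x2 \in [set a; b]%SET by rewrite e !inE eqxx.
      by rewrite !inE => /orP[]/eqP ->; auto.
    by move=> a b c d /inF2[]-> /inF2[]->; lia.
have adjS a b : a \in S -> adj G' a b ->
    [set a; b]%SET \in F1 \/ [set a; b]%SET \in F2.
  rewrite /adj G'E => aS /setUP[/setUP[/E0P[_ _]|]|]; auto.
  by move/disjointFr => /(_ a); rewrite !inE eqxx aS => /(_ isT).
have S1n2 x : x \in S1 -> x \in S2 -> False.
  by move=> xS1; rewrite (disjointFr S12).
have /card_gt0P[w0 _] : (0 < #|W|)%N by rewrite -cH.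
have comp1 : comp_of G' (f w0) = S1.
  apply: comp_closed; first by rewrite imset_f.
  - move=> a b aS1 /(adjS a b (subsetP S1S _ aS1))[/F1S/subsetP|/F2S/subsetP] ab.
      by apply: ab; rewrite !inE eqxx orbT.
    by case: (S1n2 a aS1); apply: ab; rewrite !inE eqxx.
  - move=> _ /imsetP[w _ ->]; have [[_ /(_ w0 w)/connectP[p pp ->]] _] := treeH.
    elim: p (w0) pp => [|b p IH] a //= /andP[ab pb].
    apply: connect_trans (IH b pb); apply: connect1.
    by rewrite /adj G'E -imset_set2 !inE imset_f ?orbT.
have comp2 : comp_of G' x2 = S2.
  apply: comp_closed => //.
  - move=> a b aS2 /(adjS a b (subsetP S2S _ aS2))[/F1S/subsetP|/F2S/subsetP] ab.
      by case: (S1n2 a) => //; apply: ab; rewrite !inE eqxx.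
    by apply: ab; rewrite !inE eqxx orbT.
  - move=> y yS2; have [->|yx] := eqVneq y x2; first exact: connect0.
    apply: connect1; rewrite /adj G'E inE; apply/orP; right.
    by apply/starP; exists y.
exists G', (f w0), x2; split=> //.
- have cF1 : #|F1| = #|edges H| by rewrite card_imset //; exact: imset_inj.
  have cF2 := card_star x2S2; rewrite -/F2 in cF2.
  have d1 : [disjoint E0 & F1].
    apply/pred0P => e /=; apply/negP => /andP[eE0 /F1S eS1].
    apply: (ne2 _ _ (E0_2 _ eE0) _ (subset_trans eS1 S1S)).
    by case: (E0P _ eE0).
  have d2 : [disjoint E0 :|: F1 & F2].
    apply/pred0P => e /=; apply/negP => /andP[/E0F1 eE eF2].
    exact: (ne2 _ _ (F2_2 _ eF2) eE (F2S _ eF2)).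
  have cEI : #|edges G :\: inner G S| = (#|edges G| - #|inner G S|)%N.
    rewrite cardsD (setIidPr _) //.
    by apply/subsetP => e; rewrite inE => /andP[].
  have cE0 : #|E0| = (#|edges G| - #|inner G S| - #|D|)%N.
    by rewrite cardsD (setIidPr _) ?cEI //; exact/subsetP.
  have : (#|D| <= #|edges G| - #|inner G S|)%N.
    by rewrite -cEI; apply: subset_leq_card; exact/subsetP.
  have /eqP : #|E0 :|: F1 :|: F2| == (#|E0 :|: F1| + #|F2|)%N.
    by rewrite (leq_card_setU _ _).2.
  have /eqP : #|E0 :|: F1| == (#|E0| + #|F1|)%N.
    by rewrite (leq_card_setU _ _).2.
  have iG : (#|inner G S| <= #|edges G|)%N.
    by apply: subset_leq_card; apply/subsetP => e; rewrite inE => /andP[].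
  by rewrite G'E; lia.
- rewrite comp1; apply/existsP; exists (finfun f); apply/and3P; split.
  + by apply/injectiveP => a b; rewrite !ffunE; exact: fi.
  + by apply/eqP; apply: eq_imset => w; rewrite ffunE.
  + apply/forallP => a; apply/forallP => b; rewrite !ffunE; apply/eqP.
    have aS : f a \in S by [].
    apply/idP/idP => [/(adjS _ _ aS)[|/F2S/subsetP/(_ (f a))]|abH].
    * by rewrite -imset_set2 => /imsetP[e eH /(imset_inj fi)]; rewrite /adj => ->.
    * by rewrite !inE eqxx => /(_ isT)/andP[]; rewrite imset_f.
    * by rewrite /adj G'E -imset_set2 !inE imset_f ?orbT.
- by rewrite comp1 comp2 -{1}(setID S S1) (setIidPr S1S).
- move=> e neS; rewrite G'E.
  have -> : (e \in E0 :|: F1 :|: F2) = (e \in E0).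
    rewrite !inE; apply/orP/idP => [[/orP[//|/F1S eS1]|/F2S eS2]|->]; last by left.
      by rewrite (subset_trans eS1) in neS.
    by rewrite (subset_trans eS2) in neS.
  by rewrite !inE negb_and neS orbT andbC.
Qed.

(** * Double counting of switches *)

Lemma card_dep_pairs (X Y : finType) (A : {set X}) (B : X -> {set Y}) :
  #|[set p : X * Y | (p.1 \in A) && (p.2 \in B p.1)]| = (\sum_(x in A) #|B x|)%N.
Proof.
under [RHS]eq_bigr do rewrite -sum1_card.
by rewrite pair_big_dep /= sum1dep_card.
Qed.

(** Choosing a related [y] for each [x] gives an injection. A relation is convenient because the
    switched graph is only known to exist. *)
Lemma leq_card_rel (X Y : finType) (P : {set X}) (Q : {set Y})
    (r : X -> Y -> Prop) :
  (forall x, x \in P -> exists2 y, y \in Q & r x y) ->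
  (forall x x' y, x \in P -> x' \in P -> r x y -> r x' y -> x = x') ->
  (#|P| <= #|Q|)%N.
Proof.
move=> ex uniq; have [->|/set0Pn[x0 x0P]] := eqVneq P finset.set0; first by rewrite cards0.
have [y0 _ _] := ex x0 x0P.
have [g gE] : {g : X -> Y & forall x, x \in P -> g x \in Q /\ r x (g x)}.
  apply: (@boolp.choice _ _ (fun x y => x \in P -> y \in Q /\ r x y)) => x.
  by have [/ex[y yQ rxy]|nxP] := boolP (x \in P); [exists y|exists y0].
rewrite -(_ : #|g @: P| = #|P|).
  by apply: subset_leq_card; apply/subsetP => _ /imsetP[x /gE[gQ _] ->].
apply: card_in_imset => x x' xP x'P e.
by apply: (uniq x x' (g x)) => //; [case: (gE x xP)|rewrite e; case: (gE x' x'P)].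
Qed.

Definition few_iso (R : realType) (W : finType) (H : sgraph W) (n m j : nat) :
  {set sgraph 'I_n} :=
  [set G in planar_graphs R n m | (num_components_iso G H <= j)%N].

Definition pairs (T : finType) : {set {set T}} := [set e : {set T} | #|e| == 2].

(** The factors bound, in order, the vertices in copies of [H] ([j * h]), the second vertex, the
    sets of [h - 1] pairs, and the families of subsets of a set of at most [M] vertices. *)
Definition reverse_bound (n h M j : nat) : nat :=
  (j * h * n * 'C('C(n, 2), h.-1) * 2 ^ (2 ^ M))%N.

Definition forward_choices (V : finType) (h K : nat) (G : sgraph V) :
    {set {set {set V}} * {set {set V}}} :=
  [set p : {set {set V}} * {set {set V}} |
    (p.1 \in [set B : {set {set V}} | (B \subset small_trees G K) && (#|B| == h.+1)]) &&
    (p.2 \in [set D : {set {set V}} |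
        (D \subset edges G :\: inner G (cover p.1)) && (#|D| == h.-1)])].

(** Each tree has one edge less than vertices. For [h + 1] trees this is the edge count that
    [tree_switch] requires of [S]. *)
Lemma small_trees_cover (V : finType) (G : sgraph V) (K : nat) (B : {set {set V}}) :
  B \subset small_trees G K ->
  [/\ B \subset components G, (#|cover B| <= #|B| * K)%N &
      (#|inner G (cover B)| + #|B|)%N = #|cover B|].
Proof.
move=> /subsetP BT; have BG : B \subset components G.
  by apply/subsetP => C /BT; rewrite inE => /andP[].
split=> //.
  apply: leq_trans (leq_card_cover B) _; rewrite -sum_nat_const; apply: leq_sum => C /BT.
  by rewrite inE => /and3P[].
rewrite card_inner_cover // -(eqP (trivIset_components BG)) -sum1_card -big_split /=.
apply: eq_bigr => C /BT; rewrite inE => /and3P[/componentsP[x ->] lt _].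
by apply/eqP; rewrite eqn_leq addn1 lt comp_edges.
Qed.

Lemma forward_choices_ge (n h K N m : nat) (G : sgraph 'I_n) :
  (N <= #|small_trees G K|)%N -> (m <= #|edges G|)%N ->
  ('C(N, h.+1) * 'C(m - h.+1 * K, h.-1) <= #|forward_choices h K G|)%N.
Proof.
move=> NT mG; rewrite /forward_choices (card_dep_pairs _ (fun B =>
  [set D : {set {set 'I_n}} | (D \subset edges G :\: inner G (cover B)) &&
     (#|D| == h.-1)])).
apply: (@leq_trans (\sum_(B in [set B : {set {set 'I_n}} |
    (B \subset small_trees G K) && (#|B| == h.+1)]) 'C(m - h.+1 * K, h.-1))%N).
  rewrite sum_nat_const cards_draws leq_mul2r; apply/orP; right.
  exact: leq_bin2l.
apply: leq_sum => B; rewrite inE => /andP[BT /eqP cB].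
rewrite cards_draws; apply: leq_bin2l.
(* The union has at most [h.+1 * K] vertices and fewer inner edges than vertices, so at least
   [m - h.+1 * K] edges remain for [D]. *)
have [_ cc ci] := small_trees_cover BT.
rewrite cardsD (setIidPr _); last by apply/subsetP => e; rewrite inE => /andP[].
by rewrite cB in cc ci; lia.
Qed.

(* [((v1, v2), D), E]: one vertex in each new component, the deleted edges and
   the former edges inside the union of the two components. *)
Definition reverse_choices (n : nat) (W : finType) (H : sgraph W) (M : nat)
    (G : sgraph 'I_n) :
    {set ('I_n * 'I_n * {set {set 'I_n}}) * {set {set 'I_n}}} :=
  [set q : ('I_n * 'I_n * {set {set 'I_n}}) * {set {set 'I_n}} |
    (q.1 \in [set t : 'I_n * 'I_n * {set {set 'I_n}} |
      [&& induced_iso G (comp_of G t.1.1) H,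
          (#|comp_of G t.1.1 :|: comp_of G t.1.2| <= M)%N,
          t.2 \subset pairs 'I_n & #|t.2| == #|W|.-1]]) &&
    (q.2 \in powerset (powerset (comp_of G q.1.1.1 :|: comp_of G q.1.1.2)))].

Lemma reverse_choices_le (n : nat) (W : finType) (H : sgraph W) (M j : nat)
    (G : sgraph 'I_n) :
  (num_components_iso G H <= j)%N ->
  (#|reverse_choices H M G| <= reverse_bound n #|W| M j)%N.
Proof.
move=> Gj; rewrite /reverse_choices (card_dep_pairs _ (fun t =>
  powerset (powerset (comp_of G t.1.1 :|: comp_of G t.1.2)))).
set T := [set t : 'I_n * 'I_n * {set {set 'I_n}} | _].
apply: (@leq_trans (\sum_(t in T) 2 ^ (2 ^ M))%N).
  apply: leq_sum => t; rewrite inE => /and4P[_ cM _ _].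
  by rewrite !card_powerset !leq_exp2l.
rewrite sum_nat_const leq_mul2r; apply/orP; right.
set VH := [set v | induced_iso G (comp_of G v) H].
set DD := [set D : {set {set 'I_n}} | (D \subset pairs 'I_n) && (#|D| == #|W|.-1)].
apply: (@leq_trans #|finset.setX (finset.setX VH [set: 'I_n]) DD|).
  apply: subset_leq_card; apply/subsetP => -[[v1 v2] D]; rewrite !inE /=.
  by case/and4P => -> _ -> ->.
rewrite !cardsX cardsT card_ord cards_draws /pairs card_draws card_ord.
rewrite leq_mul2r; apply/orP; right; rewrite leq_mul2r; apply/orP; right.
by apply: leq_trans (card_iso_comps G H) _; rewrite leq_mul2r Gj orbT.
Qed.

(* A graph with at most [j] copies of [H] and a forward choice are recovered from
   the switched graph and a reverse choice: the two new components span the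
   union of the chosen trees. *)
Lemma switch_count (R : realType) (W : finType) (H : sgraph W) (n m j K N M j' : nat) :
  is_tree H -> M = (#|W|.+1 * K)%N -> j' = (j + (M + #|W|.*2))%N ->
  (forall G : sgraph 'I_n, #|edges G| = m -> (N <= #|small_trees G K|)%N) ->
  (#|few_iso R H n m j| * ('C(N, #|W|.+1) * 'C(m - M, #|W|.-1)) <=
   #|few_iso R H n m j'| * reverse_bound n #|W| M j')%N.
Proof.
move=> treeH ME j'E NT; set h := #|W|.
have h0 : (0 < h)%N by rewrite /h; case: treeH => [[]].
pose P := [set p : sgraph 'I_n * ({set {set 'I_n}} * {set {set 'I_n}}) |
  (p.1 \in few_iso R H n m j) && (p.2 \in forward_choices h K p.1)].
pose Q := [set q : sgraph 'I_n * (('I_n * 'I_n * {set {set 'I_n}}) * {set {set 'I_n}}) |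
  (q.1 \in few_iso R H n m j') && (q.2 \in reverse_choices H M q.1)].
have PG : (#|few_iso R H n m j| * ('C(N, h.+1) * 'C(m - M, h.-1)) <= #|P|)%N.
  rewrite card_dep_pairs -sum_nat_const; apply: leq_sum => G.
  rewrite !inE => /andP[/andP[/eqP cG _] _].
  by rewrite ME; apply: forward_choices_ge; [exact: NT|rewrite cG].
have QG : (#|Q| <= #|few_iso R H n m j'| * reverse_bound n h M j')%N.
  rewrite card_dep_pairs -sum_nat_const; apply: leq_sum => G.
  by rewrite !inE => /andP[_ Gj]; exact: reverse_choices_le.
apply: leq_trans PG (leq_trans _ QG).
pose r (p : sgraph 'I_n * ({set {set 'I_n}} * {set {set 'I_n}}))
       (q : sgraph 'I_n * (('I_n * 'I_n * {set {set 'I_n}}) * {set {set 'I_n}})) :=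
  let: (G, (B, D)) := p in let: (G', (v1, v2, D', E)) := q in
  [/\ D' = D, E = inner G (cover B),
      cover B = (comp_of G' v1 :|: comp_of G' v2)%SET &
      forall e : {set 'I_n}, ~~ (e \subset cover B) ->
          (e \in edges G') = (e \in edges G) && (e \notin D)].
have PE G B D : (G, (B, D)) \in P -> [/\ G \in few_iso R H n m j,
    B \subset small_trees G K, #|B| = h.+1,
    D \subset edges G :\: inner G (cover B) & #|D| = h.-1].
  rewrite inE => /andP[GA]; rewrite inE => /andP[]; rewrite !(inE, in_set) /=.
  by move: GA; rewrite !inE /= => GA /andP[BT /eqP cB] /andP[DG /eqP cD]; split.
apply: (leq_card_rel (r := r)).
- move=> [G [B D]] /PE[GA BT cB DG cD].
  have [BG cc ci] := small_trees_cover BT.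
  move: GA; rewrite !inE => /andP[/andP[/eqP cG /asboolP plG] Gj].
  have clS e : e \in edges G -> [disjoint e & cover B] \/ e \subset cover B.
    exact: edge_cover.
  have ci' : (#|inner G (cover B)| + #|W|.+1)%N = #|cover B| by rewrite -ci cB.
  have cD' : #|D|.+1 = #|W| by rewrite cD prednK.
  have [G' [v1 [v2 [plG' cG' iso cov GG']]]] := tree_switch treeH plG clS ci' DG cD'.
  have DS := subsetP DG.
  exists (G', ((v1, v2, D), inner G (cover B))) => //.
  rewrite inE; apply/andP; split; [|rewrite inE; apply/andP; split; rewrite inE /=].
  + rewrite inE; apply/andP; split; first by rewrite inE cG' cG eqxx asboolT.
    (* Every changed edge lies within [cover B :|: cover D], which has at most [M + 2h] vertices;
       hence the increment from [j] to [j']. *)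
    have ZE (e : {set 'I_n}) : (e \in edges G) != (e \in edges G') -> e \subset cover B :|: cover D.
      have [eS _|neS] := boolP (e \subset cover B); first by apply: subset_trans eS (subsetUl _ _).
      rewrite GG' //; case: (e \in edges G) => //=; case: (boolP (e \in D)) => //= eD _.
      by apply: subset_trans (subsetUr _ _); exact: bigcup_sup.
    apply: leq_trans (num_components_iso_switch _ ZE) _.
    rewrite j'E; apply: leq_add => //; apply: leq_trans (leq_card_setU _ _) _.
    apply: leq_add; first by rewrite ME -cB.
    apply: leq_trans (leq_card_cover D) _.
    rewrite -muln2 -cD' mulSn (@leq_trans (\sum_(e in D) 2)%N) //.
      by apply: leq_sum => e /DS; rewrite inE => /andP[_ /card_edge ->].
    by rewrite sum_nat_const leq_addl.
  + rewrite iso -cov cD eqxx andbT ME -cB cc /=.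
    by apply/subsetP => e /DS; rewrite !inE => /andP[_ /card_edge ->].
  + rewrite -cov; by apply/subsetP => e; rewrite !inE => /andP[].
- move=> [G [B D]] [G2 [B2 D2]] [G' [[[v1 v2] D'] E]].
  move=> /PE[GA BT cB DG cD] /PE[GA2 BT2 cB2 DG2 cD2] /= [DD EE cov GG'] [DD2 EE2 cov2 GG2'].
  have ccB : cover B = cover B2 by rewrite cov cov2.
  have DDD : D = D2 by rewrite -DD -DD2.
  (* Decoding [G]: edges inside the union are read off [E], the others are those of [G'] together
     with [D]. *)
  have GE (G0 : sgraph 'I_n) (B0 : {set {set 'I_n}}) (D0 : {set {set 'I_n}}) e :
      D0 \subset edges G0 :\: inner G0 (cover B0) ->
      (forall e : {set 'I_n}, ~~ (e \subset cover B0) ->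
          (e \in edges G') = (e \in edges G0) && (e \notin D0)) ->
      (e \in edges G0) = if e \subset cover B0 then e \in inner G0 (cover B0)
                         else (e \in edges G') || (e \in D0).
    move=> /subsetP D0S h0'; case: ifP => eS; first by rewrite inE eS andbT.
    rewrite h0' ?eS //; case: (boolP (e \in D0)) => [/D0S|]; last by rewrite andbT orbF.
    by rewrite inE => /andP[_ ->].
  have GG2 : G = G2.
    apply: val_inj; apply/setP => e /=.
    by rewrite (GE _ _ _ _ DG GG') (GE _ _ _ _ DG2 GG2') -ccB -EE EE2 -ccB DDD.
  subst G2 D2; congr (_, (_, _)); last exact: DDD.
  (* Once [G] is known, [B] consists of its components inside the union. *)
  have BE (B0 : {set {set 'I_n}}) : B0 \subset small_trees G K ->
      B0 = [set C in components G | C \subset cover B0].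
    move=> B0T; have [/subsetP B0G _ _] := small_trees_cover B0T.
    apply/setP => C; rewrite inE; apply/idP/andP => [CB|[CG /subsetP CB]].
      by split; [exact: B0G|exact: bigcup_sup].
    have /componentsP[x Cx] := CG; have xC : x \in C by rewrite Cx comp_refl.
    have /bigcupP[C' C'B xC'] := CB x xC.
    by rewrite Cx -(component_eq (B0G _ C'B) xC').
  by rewrite (BE _ BT) (BE _ BT2) ccB.
Qed.

(** * Asymptotic estimates and the growth of the counts *)

Lemma leq_exp_ffact (N k : nat) : ((N - k) ^ k <= N ^_ k)%N.
Proof.
rewrite ffact_prod -[k in X in (_ ^ X <= _)%N]card_ord -prod_nat_const.
by apply: leq_prod => i _; apply: leq_sub2l; exact: ltnW.
Qed.

Lemma leq_bin_exp (N k : nat) : ('C(N, k) <= N ^ k)%N.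
Proof.
apply: (@leq_trans (N ^_ k)); first by rewrite -bin_ffact leq_pmulr // fact_gt0.
rewrite ffact_prod -[k in X in (_ <= _ ^ X)%N]card_ord -prod_nat_const.
by apply: leq_prod => i _; exact: leq_subr.
Qed.

(** Every factor of the falling factorial is at least [N - k], hence at least [x]. *)
Lemma exp_le_bin (R : realFieldType) (x : R) (N k : nat) :
  0 <= x -> x + k%:R <= N%:R -> x ^+ k / (k`!)%:R <= 'C(N, k)%:R.
Proof.
move=> x0 xN; rewrite ler_pdivrMr ?ltr0n ?fact_gt0 // -natrM bin_ffact.
have kN : (k <= N)%N by rewrite -(ler_nat R); lra.
apply: (@le_trans _ _ (((N - k) ^ k)%N%:R)); last by rewrite ler_nat leq_exp_ffact.
by rewrite natrX lerXn2r ?nnegrE ?ler0n // natrB //; lra.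
Qed.

(** The numerator is the coefficient of [n ^ (2h)] in the lower bound for forward choices; the first
    divisor is that of [j * n ^ (2h - 1)] in the bound for reverse choices. Dividing by [e] makes
    their ratio at least [e] when [j] is at most this rate times [n]. *)
Definition growth_rate (R : realType) (c d : R) (h M : nat) : R :=
  ((d / 4) ^+ h.+1 / (h.+1)`!%:R * ((c / 2) ^+ h.-1 / (h.-1)`!%:R)) /
    (h * 2 ^ (2 ^ M))%N%:R / expR 1.

Lemma reverse_bound_le (R : realType) (n h M j : nat) : (0 < h)%N ->
  (reverse_bound n h M j)%:R <=
    j%:R * (h * 2 ^ (2 ^ M))%N%:R * n%:R ^+ (h.*2).-1 :> R.
Proof.
move=> h0; rewrite -natrX -!natrM ler_nat /reverse_bound.
have le : ('C('C(n, 2), h.-1) <= (n ^ 2) ^ h.-1)%N.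
  apply: leq_trans (leq_bin_exp _ _) _.
  case: (h.-1) => [|k]; first by rewrite !expn0.
  by rewrite leq_exp2r // leq_bin_exp.
have -> : (n ^ h.*2.-1 = n * (n ^ 2) ^ h.-1)%N.
  by rewrite -expnM -expnS; congr (_ ^ _)%N; lia.
rewrite [leqRHS](_ : _ = (j * h * n * (n ^ 2) ^ h.-1 * 2 ^ (2 ^ M))%N).
  by rewrite leq_mul2r leq_mul2l le !orbT.
rewrite -!mulnA; congr (_ * (_ * _))%N; rewrite mulnCA; congr (_ * _)%N.
exact: mulnC.
Qed.

Lemma few_iso_growth (R : realType) (W : finType) (H : sgraph W) (c d : R)
    (n m j K M j' : nat) :
  is_tree H -> M = (#|W|.+1 * K)%N -> j' = (j + (M + #|W|.*2))%N ->
  0 < c -> 0 < d -> 2 <= d * K%:R ->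
  c * n%:R <= m%:R -> m%:R <= (1 - d) * n%:R ->
  (#|W| + 2)%:R <= d / 4 * n%:R -> (M + #|W|)%:R <= c / 2 * n%:R ->
  j'%:R <= growth_rate c d #|W| M * n%:R ->
  #|few_iso R H n m j|%:R * expR 1 <= #|few_iso R H n m j'|%:R :> R.
Proof.
move=> treeH ME j'E c0 d0 dK cm md nd nc j'n.
have h0 : (0 < #|W|)%N by case: treeH => [[]].
set h := #|W| in ME j'E nd nc j'n h0 *.
have n0 : 0 < n%:R :> R.
  rewrite ltr0n lt0n; apply: contraTneq nd => ->.
  by rewrite mulr0 -ltNge ltr0n addn2.
(* There are at least [d n - n / K] small trees by [many_small_trees], and [2 <= d * K] turns this
   into [d n / 2]. *)
pose N := Num.truncn (d / 2 * n%:R).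
have NE : d / 2 * n%:R - 1 <= N%:R /\ N%:R <= d / 2 * n%:R.
  have d2 : 0 <= d / 2 * n%:R by rewrite mulr_ge0 ?ler0n //; lra.
  have /andP[] := truncn_itv d2; rewrite -/N -addn1 natrD; lra.
have NT (G : sgraph 'I_n) : #|edges G| = m -> (N <= #|small_trees G K|)%N.
  move=> cG; have := many_small_trees G K; rewrite cG card_ord -(ler_nat R).
  rewrite natrD !natrM natrD -(ler_nat R) => le; apply: le_trans NE.2 _.
  have K0 : 0 < K%:R :> R.
    by rewrite ltr0n lt0n; apply: contraTneq dK => ->; rewrite mulr0 -ltNge.
  rewrite -(ler_pM2l K0).
  have : K%:R * m%:R <= K%:R * ((1 - d) * n%:R) by rewrite ler_pM2l.
  have : 2 * n%:R <= d * K%:R * n%:R by rewrite ler_pM2r.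
  by move: le; nra.
have := switch_count R treeH ME j'E NT; rewrite -(ler_nat R) -/h 3!natrM => key.
set Fw := 'C(N, h.+1)%:R * 'C(m - M, h.-1)%:R in key.
pose f1 : R := (d / 4) ^+ h.+1 / (h.+1)`!%:R; pose f2 : R := (c / 2) ^+ h.-1 / (h.-1)`!%:R.
have f1E : f1 * n%:R ^+ h.+1 <= 'C(N, h.+1)%:R.
  rewrite /f1 mulrAC -exprMn; apply: exp_le_bin; first by rewrite mulr_ge0 ?ler0n //; lra.
  (* The [#|W| + 2] in [nd] covers the [h + 1] lost in the falling factorial and the 1 lost in
     rounding [N]. *)
  by move: nd NE.1; rewrite addn2 -natr1 -[h.+1%:R]natr1; lra.
have f2E : f2 * n%:R ^+ h.-1 <= 'C(m - M, h.-1)%:R.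
  rewrite /f2 mulrAC -exprMn; apply: exp_le_bin; first by rewrite mulr_ge0 ?ler0n //; lra.
  have Mm : (M <= m)%N.
    rewrite -(ler_nat R); move: nc; rewrite natrD.
    by have : 0 <= h%:R :> R by []; nra.
  have hh : h.-1%:R <= h%:R :> R by rewrite ler_nat leq_pred.
  by rewrite natrB //; move: nc; rewrite natrD; lra.
have f10 : 0 < f1 by rewrite divr_gt0 ?ltr0n ?fact_gt0 ?exprn_gt0 //; lra.
have f20 : 0 < f2 by rewrite divr_gt0 ?ltr0n ?fact_gt0 ?exprn_gt0 //; lra.
have FwE : f1 * f2 * n%:R ^+ h.*2 <= Fw.
  have -> : f1 * f2 * n%:R ^+ h.*2 = (f1 * n%:R ^+ h.+1) * (f2 * n%:R ^+ h.-1).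
    by rewrite [RHS]mulrACA -exprD addSnnS prednK // addnn.
  by apply: ler_pM => //; apply: mulr_ge0; rewrite ?exprn_ge0 //; exact: ltW.
pose q : R := (h * 2 ^ (2 ^ M))%N%:R.
have q0 : 0 < q by rewrite ltr0n muln_gt0 h0 expn_gt0.
have e0 := expR_gt0 (1 : R).
(* Reverse choices carry one power of [n] less; the bound on [j'] supplies the missing factor and
   the gain [e]. *)
have RvE : (reverse_bound n h M j')%:R <= f1 * f2 * n%:R ^+ h.*2 / expR 1.
  apply: le_trans (reverse_bound_le _ _ _ _ h0) _; rewrite -/q.
  apply: (@le_trans _ _ (growth_rate c d h M * n%:R * q * n%:R ^+ (h.*2).-1)).
    by rewrite ler_pM2r ?exprn_gt0 // ler_pM2r.
  rewrite /growth_rate -/f1 -/f2 -/q.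
  have -> : n%:R ^+ h.*2 = n%:R * n%:R ^+ (h.*2).-1 :> R.
    by rewrite -exprS prednK // double_gt0.
  rewrite le_eqVlt; apply/orP; left; apply/eqP; clearbody q; field.
  by rewrite !gt_eqF.
have F0 : 0 < f1 * f2 * n%:R ^+ h.*2
  by apply: mulr_gt0; [exact: mulr_gt0|exact: exprn_gt0].
rewrite -(ler_pM2r F0).
apply: (@le_trans _ _ (#|few_iso R H n m j|%:R * Fw * expR 1)).
  by rewrite mulrAC ler_pM2r // ler_wpM2l.
rewrite -(ler_pM2r (_ : 0 < (expR 1)^-1)) ?invr_gt0 // mulfK ?gt_eqF //.
by apply: le_trans key _; rewrite -mulrA ler_wpM2l.
Qed.


(** Each step adds [L] copies and gains a factor [e]; the rate bound at the last step implies it at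
    all earlier ones. *)
Lemma few_iso_iter (R : realType) (W : finType) (H : sgraph W) (c d : R)
    (n m j K M L T : nat) :
  is_tree H -> M = (#|W|.+1 * K)%N -> L = (M + #|W|.*2)%N ->
  0 < c -> 0 < d -> 2 <= d * K%:R ->
  c * n%:R <= m%:R -> m%:R <= (1 - d) * n%:R ->
  (#|W| + 2)%:R <= d / 4 * n%:R -> (M + #|W|)%:R <= c / 2 * n%:R ->
  (j + T * L)%:R <= growth_rate c d #|W| M * n%:R ->
  #|few_iso R H n m j|%:R * expR T%:R <= #|few_iso R H n m (j + T * L)|%:R :> R.
Proof.
move=> treeH ME LE c0 d0 dK cm md nd nc; elim: T => [|T IH] le.
  by rewrite mul0n addn0 expR0 mulr1.
have le' : (j + T * L)%:R <= growth_rate c d #|W| M * n%:R.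
  by apply: le_trans le; rewrite ler_nat leq_add2l leq_mul2r leqnSn orbT.
rewrite -natr1 expRD mulrA.
apply: (@le_trans _ _ (#|few_iso R H n m (j + T * L)|%:R * expR 1)).
  by rewrite ler_pM2r ?expR_gt0 ?IH.
apply: (few_iso_growth treeH ME _ c0 d0 dK) => //.
by rewrite -LE mulSn addnA addnAC.
Qed.

Theorem theorem3p4 (R : realType) (W : finType) (H : sgraph W) (c A : R)
    (treeH : is_tree H) (c_gt0 : 0 < c) (A_lt1 : A < 1) :
  exists lambda : R, 0 < lambda /\
    forall m : nat -> nat,
      (\forall n \near \oo%classic,
         c * n%:R <= (m n)%:R /\ (m n)%:R <= A * n%:R) ->
      \forall n \near \oo%classic,
        planar_prob R n (m n)
          (fun G => (num_components_iso G H)%:R < lambda * n%:R)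
        < expR (- (lambda * n%:R)).
Proof.
pose d := 1 - A; have d0 : 0 < d by rewrite /d; lra.
have h0 : (0 < #|W|)%N by case: treeH => [[]].
pose K := (Num.truncn (2 / d)).+1.
have dK : 2 <= d * K%:R.
  have /andP[_ lt] : ((Num.truncn (2 / d))%:R <= 2 / d < K%:R).
    by apply: truncn_itv; rewrite divr_ge0 // ltW.
  by rewrite mulrC -ler_pdivrMr // ltW.
pose M := (#|W|.+1 * K)%N; pose L := (M + #|W|.*2)%N.
pose mu := growth_rate c d #|W| M.
have mu0 : 0 < mu.
  rewrite !divr_gt0 ?expR_gt0 ?ltr0n ?muln_gt0 ?h0 ?expn_gt0 //.
  by rewrite mulr_gt0 // divr_gt0 ?ltr0n ?fact_gt0 ?exprn_gt0 //; lra.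
(* With [j <= l n], the final count [j + (j + 1) L] is at most [l n (L + 1) + L]. The first term is
   [mu n / 2], and the other half of [mu n] absorbs [L] for large [n]. *)
pose l := mu / (2 * L.+1%:R).
have l0 : 0 < l by rewrite divr_gt0 // mulr_gt0.
exists l; split=> // m mE; near=> n.
have [cm mA] : c * n%:R <= (m n)%:R /\ (m n)%:R <= A * n%:R by near: n.
have nd : (#|W| + 2)%:R <= d / 4 * n%:R.
  rewrite mulrC -ler_pdivrMr; last by lra.
  by near: n; exact: nbhs_infty_ger.
have nc : (M + #|W|)%:R <= c / 2 * n%:R.
  rewrite mulrC -ler_pdivrMr; last by lra.
  by near: n; exact: nbhs_infty_ger.
have nL : L%:R <= mu / 2 * n%:R.
  rewrite mulrC -ler_pdivrMr; last by lra.
  by near: n; exact: nbhs_infty_ger.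
pose j := Num.truncn (l * n%:R).
have ln0 : 0 <= l * n%:R by rewrite mulr_ge0 // ltW.
have /andP[jl lj] : (j%:R <= l * n%:R < j.+1%:R) by exact: truncn_itv.
have le : (j + j.+1 * L)%:R <= mu * n%:R.
  have : l * n%:R * L.+1%:R = mu / 2 * n%:R.
    by rewrite /l; field; rewrite addrC natr1 gt_eqF.
  have : j%:R * L.+1%:R <= l * n%:R * L.+1%:R by rewrite ler_pM2r.
  rewrite natrD natrM -[j.+1%:R]natr1 -[L.+1%:R]natr1; move: nL.
  move: (j%:R) (L%:R : R) (l * n%:R) => a b x; lra.
have md : (m n)%:R <= (1 - d) * n%:R by rewrite /d; move: mA; lra.
(* There are [j + 1] steps rather than [j], because [l * n < j + 1] gives a strict inequality of
   exponentials. *)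
have := few_iso_iter treeH erefl erefl c_gt0 d0 dK cm md nd nc le.
rewrite /planar_prob; set E := finset _ => key.
have Ej : #|E|%:R <= #|few_iso R H n (m n) j|%:R :> R.
  rewrite ler_nat; apply: subset_leq_card; apply/subsetP => G.
  rewrite !inE => /andP[-> Gl]; rewrite /j.
  by rewrite /= truncn_ge_nat // ltW.
have Pj : #|few_iso R H n (m n) (j + j.+1 * L)|%:R <= #|planar_graphs R n (m n)|%:R :> R.
  by rewrite ler_nat; apply: subset_leq_card; apply/subsetP => G; rewrite inE => /andP[].
(* Without such planar graphs the quotient is 0, as the inverse of 0 is 0. *)
have [P0|P0] := posnP #|planar_graphs R n (m n)|.
  by rewrite P0 invr0 mulr0 expR_gt0.
rewrite ltr_pdivrMr ?ltr0n // expRN mulrC ltr_pdivlMr ?expR_gt0 //.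
(* The strict comparison is multiplied by [#|E|], so the empty event is treated apart. *)
have [->|E0] := posnP #|E|; first by rewrite mul0r ltr0n.
apply: (@lt_le_trans _ _ (#|E|%:R * expR j.+1%:R)).
  by rewrite ltr_pM2l ?ltr0n // ltr_expR.
apply: le_trans Pj; apply: le_trans key.
by rewrite ler_pM2r ?expR_gt0.
Unshelve. all: by end_near.
Qed.
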